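(* Let $(H,\alpha,m,\eta,\Delta,\varepsilon)$ be a quasitriangular monoidal Hom-bialgebra over $k$ with $R$-matrix $R=R^{(1)}\otimes R^{(2)}$, and let $\sigma\in H\otimes H$ be a Drinfeld twist for $H$ with inverse $\varrho=\sigma^{-1}$. Let $H^\sigma=(H,\alpha,m,\eta,\Delta^\sigma,\varepsilon)$ with $\Delta^\sigma(x)=(\sigma\Delta(x))\varrho$. Then $H^\sigma$ is a quasitriangular Hom-bialgebra (i.e. it is a Hom-bialgebra that admits an $R$-matrix).
   Context: Throughout, $k$ is a commutative ring of characteristic $0$, $\otimes=\otimes_k$, and $\Delta(c)=c_1\otimes c_2$ is Sweedler notation (sums suppressed). Products on tensor powers are componentwise; an element $X$ of $H\otimes H$ is invertible if there is $Y$ with $XY=YX=1_H\otimes 1_H$. $\Delta^{op}(x)=x_2\otimes x_1$. Monoidal Hom-algebra: a $k$-module $A$ with a linear automorphism $\alpha$, a linear multiplication $m(a\otimes b)=ab$ and an element $1_A=\eta(1_k)$ such that $\alpha(ab)=\alpha(a)\alpha(b)$, $\alpha(a)(bc)=(ab)\alpha(c)$, $\alpha(1_A)=1_A$, $1_Aa=a1_A=\alpha(a)$. Monoidal Hom-coalgebra: a $k$-module $C$ with a linear automorphism $\gamma$ and linear maps $\Delta:C\to C\otimes C$, $\varepsilon:C\to k$ such that $\Delta(\gamma(c))=\gamma(c_1)\otimes\gamma(c_2)$, $\gamma^{-1}(c_1)\otimes\Delta(c_2)=\Delta(c_1)\otimes\gamma^{-1}(c_2)$, $\varepsilon\circ\gamma=\varepsilon$,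 $\varepsilon(c_1)c_2=c_1\varepsilon(c_2)=\gamma^{-1}(c)$. Monoidal Hom-bialgebra: $(H,\alpha,m,\eta,\Delta,\varepsilon)$ such that $(H,\alpha,m,\eta)$ is a monoidal Hom-algebra, $(H,\alpha,\Delta,\varepsilon)$ is a monoidal Hom-coalgebra, and $\Delta$, $\varepsilon$ are multiplicative and preserve the unit. Hom-algebra: as a monoidal Hom-algebra, but $\alpha$ is only required to be linear. Hom-coalgebra: a $k$-module $C$ with linear maps $\alpha:C\to C$, $\Delta$, $\varepsilon$ such that $\Delta(\alpha(c))=\alpha(c_1)\otimes\alpha(c_2)$, $\alpha(c_1)\otimes\Delta(c_2)=\Delta(c_1)\otimes\alpha(c_2)$, $\varepsilon\circ\alpha=\varepsilon$, $\varepsilon(c_1)c_2=c_1\varepsilon(c_2)=\alpha(c)$. Hom-bialgebra: $(B,\alpha,m,\eta,\Delta,\varepsilon)$ that is both a Hom-algebra and a Hom-coalgebra (same $\alpha$), with $\Delta,\varepsilon$ multiplicative, compatible with the structure maps, and unit-preserving. $R$-matrix of a monoidal Hom-bialgebra $(H,\alpha)$: an invertible $R=R^{(1)}\otimes R^{(2)}=r^{(1)}\otimes r^{(2)}\in H\otimes H$ with $(\alpha\otimes\alpha)R=R$; $R\Delta(h)=\Delta^{op}(h)R$ for all $h\in H$; $R^{(1)}_1\otimes R^{(1)}_2\otimes R^{(2)}=r^{(1)}\otimes R^{(1)}\otimes r^{(2)}R^{(2)}$; $R^{(1)}\otimes R^{(2)}_1\otimes R^{(2)}_2=r^{(1)}R^{(1)}\otimes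 R^{(2)}\otimes r^{(2)}$. A monoidal Hom-bialgebra with an $R$-matrix is called quasitriangular. $R$-matrix of a Hom-bialgebra $(B,\alpha)$: an invertible $R=R^{(1)}\otimes R^{(2)}=r^{(1)}\otimes r^{(2)}\in B\otimes B$ with $(\alpha\otimes\alpha)R=R$; $R\Delta(x)=\Delta^{op}(x)R$ for all $x\in B$; $R^{(1)}_1\otimes R^{(1)}_2\otimes\alpha(R^{(2)})=\alpha(r^{(1)})\otimes\alpha(R^{(1)})\otimes r^{(2)}R^{(2)}$; $\alpha(R^{(1)})\otimes R^{(2)}_1\otimes R^{(2)}_2=r^{(1)}R^{(1)}\otimes\alpha(R^{(2)})\otimes\alpha(r^{(2)})$. A Hom-bialgebra with an $R$-matrix is called quasitriangular. Drinfeld twist for $H$: an invertible $\sigma=\sigma^{(1)}\otimes\sigma^{(2)}=\bar\sigma^{(1)}\otimes\bar\sigma^{(2)}\in H\otimes H$ such that $(\alpha\otimes\alpha)(\sigma)=\sigma$; $(\varepsilon\otimes id)(\sigma)=(id\otimes\varepsilon)(\sigma)=1_H$; and $\sigma^{(1)}\otimes\bar\sigma^{(1)}\sigma^{(2)}_1\otimes\bar\sigma^{(2)}\sigma^{(2)}_2=\bar\sigma^{(1)}\sigma^{(1)}_1\otimes\bar\sigma^{(2)}\sigma^{(1)}_2\otimes\sigma^{(2)}$. *)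

(* Defs.v *)
From HB Require Import structures.
From mathcomp Require Import all_boot all_order all_algebra.
From mathcomp Require Import boolp.

Set Implicit Arguments.
Unset Strict Implicit.
Unset Printing Implicit Defensive.

Import GRing.Theory.
Local Open Scope ring_scope.
Local Open Scope quotient_scope.

Reserved Notation "a ⊗ b" (at level 40, no associativity).
Reserved Notation "M ⊗[ k ] N" (at level 40, no associativity,
  format "M  ⊗[ k ]  N").
Reserved Notation "\sw_ ( a ⊗ b <- t ) E"
  (at level 41, a name, b name, t at level 60, right associativity,
   format "\sw_ ( a  ⊗  b  <-  t )  E").

(* The tensor product of modules over a commutative ring, by generators and
   relations: a formal sum of pure tensors a_i ⊗ b_i is the list of the pairs
   (a_i, b_i), and formal sums are identified modulo the congruence (for
   concatenation) generated by commutativity and bilinearity.  No formal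
   coefficients are needed since c (a ⊗ b) = (c a) ⊗ b. *)
Section Tensor.
Context {k : comNzRingType}.

Inductive tensor_cong (M N : lmodType k) : seq (M * N) -> seq (M * N) -> Prop :=
| tcong_refl s : tensor_cong s s
| tcong_sym s t : tensor_cong s t -> tensor_cong t s
| tcong_trans s t u : tensor_cong s t -> tensor_cong t u -> tensor_cong s u
| tcong_cat s s' t t' :
    tensor_cong s s' -> tensor_cong t t' -> tensor_cong (s ++ t) (s' ++ t')
| tcong_catC s t : tensor_cong (s ++ t) (t ++ s)
| tcong_addl a a' b : tensor_cong [:: (a + a', b)] [:: (a, b); (a', b)]
| tcong_addr a b b' : tensor_cong [:: (a, b + b')] [:: (a, b); (a, b')]
| tcong_scale c a b : tensor_cong [:: (c *: a, b)] [:: (a, c *: b)]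
| tcong_zero b : tensor_cong [:: (0, b)] [::].

Section Quotient.
Variables M N : lmodType k.
Implicit Types (s t : seq (M * N)) (c : k).

Definition tensor_rel s t : bool := `[< tensor_cong s t >].

Lemma tensor_rel_refl : reflexive tensor_rel.
Proof. by move=> s; apply/asboolP; apply: tcong_refl. Qed.

Lemma tensor_rel_sym : symmetric tensor_rel.
Proof. by move=> s t; apply/asboolP/asboolP; apply: tcong_sym. Qed.

Lemma tensor_rel_trans : transitive tensor_rel.
Proof.
by move=> s t u /asboolP ts /asboolP su; apply/asboolP; apply: tcong_trans ts su.
Qed.

Canonical tensor_equiv :=
  EquivRel tensor_rel tensor_rel_refl tensor_rel_sym tensor_rel_trans.

Definition tensor : Type := {eq_quot tensor_equiv}.
HB.instance Definition _ := Choice.on tensor.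
HB.instance Definition _ := EqQuotient.on tensor.

Definition formal_tensor s : tensor := \pi_tensor s.

Lemma formal_tensorP s t : formal_tensor s = formal_tensor t <-> tensor_cong s t.
Proof.
split=> [/eqP|st]; first by rewrite piE => /asboolP.
by apply/eqP; rewrite piE; apply/asboolP.
Qed.

Lemma formal_tensorK (x : tensor) : formal_tensor (repr x) = x.
Proof. exact: reprK. Qed.

Lemma repr_formal_tensor s : tensor_cong (repr (formal_tensor s)) s.
Proof. by apply/formal_tensorP; rewrite formal_tensorK. Qed.

Definition formal_scale c s := [seq (c *: p.1, p.2) | p <- s].

Definition tensor_zero : tensor := formal_tensor [::].
Definition tensor_add (x y : tensor) : tensor := formal_tensor (repr x ++ repr y).
Definition tensor_scale c (x : tensor) : tensor :=
  formal_tensor (formal_scale c (repr x)).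

Lemma formal_scale_cong c s t :
  tensor_cong s t -> tensor_cong (formal_scale c s) (formal_scale c t).
Proof.
elim=> {s t} /=.
- by move=> s; apply: tcong_refl.
- by move=> s t _; apply: tcong_sym.
- by move=> s t u _ st _; apply: tcong_trans.
- move=> s s' t t' _ ss' _ tt'; rewrite /formal_scale !map_cat.
  exact: tcong_cat.
- by move=> s t; rewrite /formal_scale !map_cat; apply: tcong_catC.
- by move=> a a' b; rewrite scalerDr; apply: tcong_addl.
- by move=> a b b'; apply: tcong_addr.
- by move=> d a b; rewrite scalerA mulrC -scalerA; apply: tcong_scale.
- by move=> b; rewrite scaler0; apply: tcong_zero.
Qed.

Lemma tensor_addE s t :
  tensor_add (formal_tensor s) (formal_tensor t) = formal_tensor (s ++ t).
Proof.
by apply/formal_tensorP; exact: tcong_cat (repr_formal_tensor s) (repr_formal_tensor t).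
Qed.

Lemma tensor_scaleE c s :
  tensor_scale c (formal_tensor s) = formal_tensor (formal_scale c s).
Proof. exact/formal_tensorP/formal_scale_cong/repr_formal_tensor. Qed.

Lemma formal_tensorW (P : tensor -> Prop) :
  (forall s, P (formal_tensor s)) -> forall x, P x.
Proof. by move=> Ps x; rewrite -(formal_tensorK x). Qed.

Lemma tensor_addA : associative tensor_add.
Proof.
elim/formal_tensorW=> s; elim/formal_tensorW=> t; elim/formal_tensorW=> u.
by rewrite !tensor_addE catA.
Qed.

Lemma tensor_addC : commutative tensor_add.
Proof.
elim/formal_tensorW=> s; elim/formal_tensorW=> t; rewrite !tensor_addE.
by apply/formal_tensorP; apply: tcong_catC.
Qed.

Lemma tensor_add0 : left_id tensor_zero tensor_add.
Proof. by elim/formal_tensorW=> s; rewrite tensor_addE. Qed.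

Lemma tensor_scaleDl x : {morph tensor_scale^~ x : c d / c + d >-> tensor_add c d}.
Proof.
elim/formal_tensorW: x => s c d; rewrite !tensor_scaleE tensor_addE.
apply/formal_tensorP; elim: s => [|[a b] s IHs] /=; first exact: tcong_refl.
rewrite scalerDl; set u := formal_scale c s; set v := formal_scale d s.
apply: (tcong_trans (tcong_cat (tcong_addl (c *: a) (d *: a) b) IHs)).
apply: (@tcong_cat _ _ [:: _] [:: _] _ _ (tcong_refl _)).
rewrite -(cat1s _ v) -/([:: (d *: a, b)] ++ (u ++ v)) !catA.
by apply: tcong_cat (tcong_refl _); apply: tcong_catC.
Qed.

Lemma tensor_scale0 x : tensor_scale 0 x = tensor_zero.
Proof.
elim/formal_tensorW: x => s; rewrite tensor_scaleE; apply/formal_tensorP.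
elim: s => [|[a b] s IHs] /=; first exact: tcong_refl.
by rewrite scale0r; apply: tcong_cat (tcong_zero M b) IHs.
Qed.

Lemma tensor_scale1 : left_id 1 tensor_scale.
Proof.
elim/formal_tensorW=> s; rewrite tensor_scaleE /formal_scale; congr formal_tensor.
by rewrite -[RHS]map_id; apply: eq_map => -[a b] /=; rewrite scale1r.
Qed.

Lemma tensor_addN : left_inverse tensor_zero (tensor_scale (-1)) tensor_add.
Proof.
move=> x; rewrite -{2}[x]tensor_scale1.
have /= <- := tensor_scaleDl x (-1) 1.
by rewrite addNr tensor_scale0.
Qed.

HB.instance Definition _ :=
  GRing.isZmodule.Build tensor tensor_addA tensor_addC tensor_add0 tensor_addN.

Lemma tensor_scaleA c d x : tensor_scale c (tensor_scale d x) = tensor_scale (c * d) x.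
Proof.
elim/formal_tensorW: x => s; rewrite !tensor_scaleE /formal_scale -map_comp.
by congr formal_tensor; apply: eq_map => -[a b] /=; rewrite scalerA.
Qed.

Lemma tensor_scaleDr : right_distributive tensor_scale tensor_add.
Proof.
move=> c; elim/formal_tensorW=> s; elim/formal_tensorW=> t.
by rewrite tensor_addE !tensor_scaleE tensor_addE /formal_scale map_cat.
Qed.

HB.instance Definition _ := GRing.Zmodule_isLmodule.Build k tensor
  tensor_scaleA tensor_scale1 tensor_scaleDr tensor_scaleDl.

Definition tens (a : M) (b : N) : tensor := formal_tensor [:: (a, b)].

(* Sweedler notation: the value at t of the linear map induced by f, computed
   on a chosen decomposition of t as a sum of pure tensors.  It does not
   depend on that decomposition when f is bilinear: see tensor_sw_tens,
   tensor_sw_linear and tensor_sw_unique. *)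
Definition tensor_sw (P : nmodType) (f : M -> N -> P) (t : tensor) : P :=
  \sum_(p <- repr t) f p.1 p.2.

End Quotient.

End Tensor.

Arguments tensor k M N : clear implicits.
Notation "M ⊗[ k ] N" := (tensor k M N) : type_scope.
Notation "a ⊗ b" := (tens a b) : ring_scope.
Notation "\sw_ ( a ⊗ b <- t ) E" := (tensor_sw (fun a b => E) t) : ring_scope.

Section TensorTheory.
Context {k : comNzRingType} {M N : lmodType k}.
Implicit Types (t : M ⊗[k] N) (P : lmodType k).

Lemma formal_tensorD (s s' : seq (M * N)) :
  formal_tensor s + formal_tensor s' = formal_tensor (s ++ s').
Proof. exact: tensor_addE. Qed.

Lemma formal_tensorZ c (s : seq (M * N)) :
  c *: formal_tensor s = formal_tensor (formal_scale c s).
Proof. exact: tensor_scaleE. Qed.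

Lemma tens_bilinear : bilinear_for *:%R *:%R (@tens k M N).
Proof.
split=> [b c a a'|a c b b']; rewrite /tens /= formal_tensorZ formal_tensorD.
  by apply/formal_tensorP; apply: tcong_addl.
apply/formal_tensorP; apply: tcong_trans (tcong_addr _ _ _) _.
apply: (@tcong_cat _ _ _ [:: _] [:: _] _ _ _ (tcong_refl _)).
by apply: tcong_sym; apply: tcong_scale.
Qed.

Lemma tensor_decomp t : t = \sum_(p <- repr t) p.1 ⊗ p.2.
Proof.
rewrite -{1}[t]formal_tensorK; elim: (repr t) => [|[a b] s IHs].
  by rewrite big_nil.
by rewrite big_cons -IHs -cat1s -formal_tensorD.
Qed.

Lemma formal_sum_cong P (f : M -> N -> P) s s' :
    bilinear_for *:%R *:%R f -> tensor_cong s s' ->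
  \sum_(p <- s) f p.1 p.2 = \sum_(p <- s') f p.1 p.2.
Proof.
move=> [fl fr]; elim=> {s s'} //=.
- by move=> s t u _ -> _ ->.
- by move=> s s' t t' _ st _ tt; rewrite !big_cat /= st tt.
- by move=> s t; rewrite !big_cat /= addrC.
- move=> a a' b; rewrite !big_cons !big_nil !addr0 /=.
  by have := fl b 1 a a'; rewrite /= !scale1r.
- move=> a b b'; rewrite !big_cons !big_nil !addr0 /=.
  by have := fr a 1 b b'; rewrite /= !scale1r.
- move=> c a b; rewrite !big_cons !big_nil !addr0 /=.
  have f0b : f 0 b = 0.
    by have := fl b (-1) 0 0; rewrite /= scaler0 add0r scaleN1r addNr.
  have fa0 : f a 0 = 0.
    by have := fr a (-1) 0 0; rewrite /= scaler0 add0r scaleN1r addNr.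
  have := fl b c a 0; have := fr a c b 0.
  by rewrite /= !addr0 f0b fa0 !addr0 => -> ->.
- move=> b; rewrite big_cons !big_nil addr0 /=.
  by have := fl b (-1) 0 0; rewrite /= scaler0 add0r scaleN1r addNr.
Qed.

Lemma tensor_sw_tens P (f : M -> N -> P) a b :
  bilinear_for *:%R *:%R f -> \sw_(x ⊗ y <- a ⊗ b) f x y = f a b.
Proof.
move=> fbil; rewrite /tensor_sw (formal_sum_cong fbil (repr_formal_tensor _)).
by rewrite big_cons big_nil addr0.
Qed.

Lemma tensor_sw_linear P (f : M -> N -> P) :
  bilinear_for *:%R *:%R f -> linear (tensor_sw f).
Proof.
move=> fbil; have [fl _] := fbil.
have swE s : tensor_sw f (formal_tensor s) = \sum_(p <- s) f p.1 p.2.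
  exact: formal_sum_cong fbil (repr_formal_tensor _).
have fZ c a b : f (c *: a) b = c *: f a b.
  have f0b : f 0 b = 0.
    by have := fl b (-1) 0 0; rewrite /= scaler0 add0r scaleN1r addNr.
  by have := fl b c a 0; rewrite /= !addr0 f0b addr0.
move=> c x y; rewrite -[x]formal_tensorK -[y]formal_tensorK.
rewrite formal_tensorZ formal_tensorD !swE.
rewrite big_cat big_map scaler_sumr; congr (_ + _).
by apply: eq_bigr => p _; rewrite fZ.
Qed.

Lemma tensor_sw_unique P (f : M -> N -> P) (g : {linear M ⊗[k] N -> P}) :
  (forall a b, g (a ⊗ b) = f a b) -> g =1 tensor_sw f.
Proof.
move=> gE t; rewrite [in LHS](tensor_decomp t) linear_sum.
by apply: eq_bigr => p _; rewrite gE.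
Qed.

End TensorTheory.

Section HomStructures.
Context {k : comNzRingType}.

Definition tensor_map (M M' N N' : lmodType k) (f : M -> M') (g : N -> N')
    (t : M ⊗[k] N) : M' ⊗[k] N' :=
  \sw_(a ⊗ b <- t) f a ⊗ g b.

Definition tensor_flip (M N : lmodType k) (t : M ⊗[k] N) : N ⊗[k] M :=
  \sw_(a ⊗ b <- t) b ⊗ a.

(* Elements of the triple tensor power are bracketed as H ⊗ (H ⊗ H). *)
Section Structures.
Variable H : lmodType k.
Implicit Types (alpha : H -> H) (m : H ⊗[k] H -> H) (eta : k^o -> H).
Implicit Types (Delta : H -> H ⊗[k] H) (eps : H -> k).
Implicit Types (R S X Y sigma rho : H ⊗[k] H).

Definition tensor_mul m X Y : H ⊗[k] H :=
  \sw_(a ⊗ b <- X) \sw_(c ⊗ d <- Y) m (a ⊗ c) ⊗ m (b ⊗ d).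

Definition tensor_one eta : H ⊗[k] H := eta 1 ⊗ eta 1.

Definition tensor_inverse m eta X Y : Prop :=
  tensor_mul m X Y = tensor_one eta /\ tensor_mul m Y X = tensor_one eta.

Definition tensor_invertible m eta X : Prop :=
  exists Y, tensor_inverse m eta X Y.

Record is_Hom_algebra alpha m eta : Prop := {
  hom_alg_alpha_linear : linear alpha;
  hom_alg_mul_linear : linear m;
  hom_alg_unit_linear : linear eta;
  hom_alg_alphaM a b : alpha (m (a ⊗ b)) = m (alpha a ⊗ alpha b);
  hom_alg_mulA a b c : m (alpha a ⊗ m (b ⊗ c)) = m (m (a ⊗ b) ⊗ alpha c);
  hom_alg_alpha1 : alpha (eta 1) = eta 1;
  hom_alg_mul1l a : m (eta 1 ⊗ a) = alpha a;
  hom_alg_mul1r a : m (a ⊗ eta 1) = alpha a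
}.

Definition is_monoidal_Hom_algebra alpha m eta : Prop :=
  bijective alpha /\ is_Hom_algebra alpha m eta.

(* A common shape of the two coalgebra notions: beta is gamma^-1 for monoidal
   Hom-coalgebras, and gamma itself for Hom-coalgebras. *)
Record Hom_coalgebra_axioms gamma beta Delta eps : Prop := {
  hom_coalg_gamma_linear : linear gamma;
  hom_coalg_comul_linear : linear Delta;
  hom_coalg_counit_linear : scalar eps;
  hom_coalg_gammaD c : Delta (gamma c) = tensor_map gamma gamma (Delta c);
  hom_coalg_coassoc c :
    \sw_(c1 ⊗ c2 <- Delta c) beta c1 ⊗ Delta c2 =
    \sw_(c1 ⊗ c2 <- Delta c) \sw_(c11 ⊗ c12 <- Delta c1) c11 ⊗ (c12 ⊗ beta c2);
  hom_coalg_eps_gamma c : eps (gamma c) = eps c;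
  hom_coalg_counitl c : \sw_(c1 ⊗ c2 <- Delta c) eps c1 *: c2 = beta c;
  hom_coalg_counitr c : \sw_(c1 ⊗ c2 <- Delta c) eps c2 *: c1 = beta c
}.

Definition is_Hom_coalgebra gamma Delta eps : Prop :=
  Hom_coalgebra_axioms gamma gamma Delta eps.

Definition is_monoidal_Hom_coalgebra gamma Delta eps : Prop :=
  exists gamma_inv, [/\ cancel gamma gamma_inv, cancel gamma_inv gamma
    & Hom_coalgebra_axioms gamma gamma_inv Delta eps].

Record bialgebra_compat m eta Delta eps : Prop := {
  comul_mul a b : Delta (m (a ⊗ b)) = tensor_mul m (Delta a) (Delta b);
  comul_one : Delta (eta 1) = tensor_one eta;
  counit_mul a b : eps (m (a ⊗ b)) = eps a * eps b;
  counit_one : eps (eta 1) = 1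
}.

Record is_monoidal_Hom_bialgebra alpha m eta Delta eps : Prop := {
  mHbialg_alg : is_monoidal_Hom_algebra alpha m eta;
  mHbialg_coalg : is_monoidal_Hom_coalgebra alpha Delta eps;
  mHbialg_compat : bialgebra_compat m eta Delta eps
}.

Record is_Hom_bialgebra alpha m eta Delta eps : Prop := {
  Hbialg_alg : is_Hom_algebra alpha m eta;
  Hbialg_coalg : is_Hom_coalgebra alpha Delta eps;
  Hbialg_compat : bialgebra_compat m eta Delta eps
}.

Record is_monoidal_R_matrix alpha m eta Delta R : Prop := {
  mRmx_invertible : tensor_invertible m eta R;
  mRmx_alpha : tensor_map alpha alpha R = R;
  mRmx_comul h :
    tensor_mul m R (Delta h) = tensor_mul m (tensor_flip (Delta h)) R;
  mRmx_comull :
    \sw_(R1 ⊗ R2 <- R) \sw_(R11 ⊗ R12 <- Delta R1) R11 ⊗ (R12 ⊗ R2) =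
    \sw_(r1 ⊗ r2 <- R) \sw_(R1 ⊗ R2 <- R) r1 ⊗ (R1 ⊗ m (r2 ⊗ R2));
  mRmx_comulr :
    \sw_(R1 ⊗ R2 <- R) R1 ⊗ Delta R2 =
    \sw_(r1 ⊗ r2 <- R) \sw_(R1 ⊗ R2 <- R) m (r1 ⊗ R1) ⊗ (R2 ⊗ r2)
}.

Record is_R_matrix alpha m eta Delta R : Prop := {
  Rmx_invertible : tensor_invertible m eta R;
  Rmx_alpha : tensor_map alpha alpha R = R;
  Rmx_comul x :
    tensor_mul m R (Delta x) = tensor_mul m (tensor_flip (Delta x)) R;
  Rmx_comull :
    \sw_(R1 ⊗ R2 <- R) \sw_(R11 ⊗ R12 <- Delta R1) R11 ⊗ (R12 ⊗ alpha R2) =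
    \sw_(r1 ⊗ r2 <- R) \sw_(R1 ⊗ R2 <- R)
      alpha r1 ⊗ (alpha R1 ⊗ m (r2 ⊗ R2));
  Rmx_comulr :
    \sw_(R1 ⊗ R2 <- R) alpha R1 ⊗ Delta R2 =
    \sw_(r1 ⊗ r2 <- R) \sw_(R1 ⊗ R2 <- R)
      m (r1 ⊗ R1) ⊗ (alpha R2 ⊗ alpha r2)
}.

Definition is_quasitriangular_Hom_bialgebra alpha m eta Delta eps : Prop :=
  is_Hom_bialgebra alpha m eta Delta eps /\
  exists R, is_R_matrix alpha m eta Delta R.

(* In the cocycle condition s stands for σ and z for \bar σ. *)
Record is_Drinfeld_twist alpha m eta Delta eps sigma : Prop := {
  twist_invertible : tensor_invertible m eta sigma;
  twist_alpha : tensor_map alpha alpha sigma = sigma;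
  twist_counitl : \sw_(s1 ⊗ s2 <- sigma) eps s1 *: s2 = eta 1;
  twist_counitr : \sw_(s1 ⊗ s2 <- sigma) eps s2 *: s1 = eta 1;
  twist_cocycle :
    \sw_(s1 ⊗ s2 <- sigma) \sw_(s21 ⊗ s22 <- Delta s2) \sw_(z1 ⊗ z2 <- sigma)
      s1 ⊗ (m (z1 ⊗ s21) ⊗ m (z2 ⊗ s22)) =
    \sw_(s1 ⊗ s2 <- sigma) \sw_(s11 ⊗ s12 <- Delta s1) \sw_(z1 ⊗ z2 <- sigma)
      m (z1 ⊗ s11) ⊗ (m (z2 ⊗ s12) ⊗ s2)
}.

Definition twisted_comul m Delta sigma rho (x : H) : H ⊗[k] H :=
  tensor_mul m (tensor_mul m sigma (Delta x)) rho.

End Structures.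
End HomStructures.

(* Main.v *)
From HB Require Import structures.
Require Import Defs.
From mathcomp Require Import all_boot all_order all_algebra.
From mathcomp Require Import boolp.
Set Implicit Arguments.
Unset Strict Implicit.
Unset Printing Implicit Defensive.
Import GRing.Theory.
Local Open Scope ring_scope.

(* Since alpha is bijective, a · b := alpha^-1 (ab) and D := Delta ∘ alpha turn
   H into an ordinary bialgebra A, of which alpha is an automorphism.  As R and
   sigma are alpha-invariant, the Hom-axioms for R and sigma become the usual
   axioms of an R-matrix and of a Drinfeld twist F = sigma of A, with inverse G.
   By Drinfeld, D^F := F D(-) G is again a quasitriangular bialgebra structure,
   with R-matrix R^F := F_21 R G, and Delta^sigma = D^F ∘ alpha, so H^sigma is
   the Yau twist of (A, D^F) along alpha.

   For the hexagon identities of R^F, the cocycle condition and its images under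
   permutations of the tensor factors move the factors F and G past R, e.g.
     F_12 (D ⊗ id)(F_21) = F_31 rot((D ⊗ id) F),
     rot((D ⊗ id) F) R_13 = R_13 swap23((D ⊗ id) F),
     swap23((D ⊗ id) F) (id ⊗ D^op) G = G_13 F_32. *)

(* The augmentation makes every algebra below nontrivial, as MathComp requires
   of an [algType], and this property is inherited by tensor products. *)
HB.mixin Record hasAugmentation (k : comNzRingType) A of GRing.Algebra k A := {
  aug : A -> k;
  aug_linear : scalar aug;
  aug_monoid_morphism : monoid_morphism aug
}.

#[short(type="augAlgType")]
HB.structure Definition AugAlgebra (k : comNzRingType) :=
  {A of GRing.Algebra k A & hasAugmentation k A}.

HB.instance Definition _ (k : comNzRingType) (A : augAlgType k) :=
  GRing.isLinear.Build k A k *%R (@aug k A) aug_linear.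
HB.instance Definition _ (k : comNzRingType) (A : augAlgType k) :=
  GRing.isMonoidMorphism.Build A k (@aug k A) aug_monoid_morphism.

(** * Linear maps on tensor products *)

Section TensorLinear.
Context {k : comNzRingType}.
Implicit Types M N P : lmodType k.

HB.instance Definition _ M N := bilinear_isBilinear.Build k M N (M ⊗[k] N)
  *:%R *:%R (@tens k M N) tens_bilinear.

(** Scalars can be absorbed into a factor, so every tensor is reached from 0 by adding pure tensors
    one at a time. *)
Lemma tensor_ind M N (Q : M ⊗[k] N -> Prop) :
  Q 0 -> (forall a b t, Q t -> Q (a ⊗ b + t)) -> forall t, Q t.
Proof.
move=> Q0 QD t; rewrite (tensor_decomp t).
by elim: (repr t) => [|[a b] s IHs]; rewrite ?big_nil ?big_cons //; apply: QD.
Qed.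

Lemma tensor_ext M N P (f g : {linear M ⊗[k] N -> P}) :
  (forall a b, f (a ⊗ b) = g (a ⊗ b)) -> f =1 g.
Proof.
by move=> fg; elim/tensor_ind=> [|a b t IHt]; rewrite ?linear0 ?linearD ?fg ?IHt.
Qed.

Arguments tensor_ind [M N] Q.
Arguments tensor_ext [M N P] f g.

Section Map.
Variables (M M' N N' : lmodType k) (f : {linear M -> M'}) (g : {linear N -> N'}).

Lemma tensor_map_bilinear : bilinear_for *:%R *:%R (fun a b => f a ⊗ g b).
Proof. by split=> [b c a a'|a c b b'] /=; rewrite linearP ?linearPl ?linearPr. Qed.

HB.instance Definition _ := GRing.isLinear.Build k _ _ _ (tensor_map f g)
  (tensor_sw_linear tensor_map_bilinear).

Lemma tensor_mapE a b : tensor_map f g (a ⊗ b) = f a ⊗ g b.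
Proof. exact: tensor_sw_tens tensor_map_bilinear. Qed.
End Map.

Section Flip.
Variables M N : lmodType k.
Lemma tensor_flip_bilinear : bilinear_for *:%R *:%R (fun (a : M) (b : N) => b ⊗ a).
Proof. by split=> [b c a a'|a c b b'] /=; rewrite ?linearPl ?linearPr. Qed.

HB.instance Definition _ := GRing.isLinear.Build k _ _ _ (@tensor_flip k M N)
  (tensor_sw_linear tensor_flip_bilinear).

Lemma tensor_flipE (a : M) (b : N) : tensor_flip (a ⊗ b) = b ⊗ a.
Proof. exact: tensor_sw_tens tensor_flip_bilinear. Qed.
End Flip.

Section Assoc.
Variables M N P : lmodType k.

Definition tensor_assoc (t : (M ⊗[k] N) ⊗[k] P) : M ⊗[k] (N ⊗[k] P) :=
  \sw_(u ⊗ c <- t) \sw_(a ⊗ b <- u) a ⊗ (b ⊗ c).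

Lemma tensor_assoc_bilinear1 c :
  bilinear_for *:%R *:%R (fun (a : M) (b : N) => a ⊗ (b ⊗ c : N ⊗[k] P)).
Proof.
by split=> [b d a a'|a d b b'] /=; rewrite ?(linearPl, linearPr) ?linearPr.
Qed.

Lemma tensor_assoc_bilinear2 : bilinear_for *:%R *:%R
  (fun (u : M ⊗[k] N) (c : P) => \sw_(a ⊗ b <- u) a ⊗ (b ⊗ c)).
Proof.
split=> [c|u d c c'] /=; first exact: tensor_sw_linear (tensor_assoc_bilinear1 c).
rewrite /tensor_sw scaler_sumr -big_split.
by apply: eq_bigr => p _; rewrite !linearPr.
Qed.

HB.instance Definition _ := GRing.isLinear.Build k _ _ _ tensor_assoc
  (tensor_sw_linear tensor_assoc_bilinear2).

Lemma tensor_assocE a b c : tensor_assoc ((a ⊗ b) ⊗ c) = a ⊗ (b ⊗ c).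
Proof.
rewrite /tensor_assoc (tensor_sw_tens _ _ tensor_assoc_bilinear2).
exact: tensor_sw_tens (tensor_assoc_bilinear1 c).
Qed.
End Assoc.

Lemma tensor_flipK M N : cancel (@tensor_flip k M N) (@tensor_flip k N M).
Proof.
move=> t; move: t.
apply: (tensor_ext (@tensor_flip k N M \o @tensor_flip k M N) idfun) => a b /=.
by rewrite !tensor_flipE.
Qed.

Lemma tensor_mapK M M' N N' (f : {linear M -> M'}) (g : {linear N -> N'})
    (f' : {linear M' -> M}) (g' : {linear N' -> N}) :
  cancel f f' -> cancel g g' -> cancel (tensor_map f g) (tensor_map f' g').
Proof.
move=> fK gK; apply: (tensor_ext (tensor_map f' g' \o tensor_map f g) idfun) => a b.
by rewrite /= !tensor_mapE fK gK.
Qed.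
End TensorLinear.

Arguments tensor_ind [k M N] Q.
Arguments tensor_ext [k M N P] f g.

(** * Tensor products of algebras *)

Section TensorAlgebra.
Context {k : comNzRingType}.
Variables A B : augAlgType k.
Implicit Types (x y z : A ⊗[k] B).

Lemma tensor_prod_bilinear1 (a : A) (b : B) :
  bilinear_for *:%R *:%R (fun (c : A) (d : B) => (a * c) ⊗ (b * d)).
Proof.
split=> [d e c c'|c e d d'] /=; rewrite mulrDr -scalerAr ?linearPl ?linearPr //.
Qed.

Lemma tensor_prod_bilinear2 y : bilinear_for *:%R *:%R
  (fun (a : A) (b : B) => \sw_(c ⊗ d <- y) (a * c) ⊗ (b * d)).
Proof.
by split=> [b e a a'|a e b b'] /=; rewrite /tensor_sw scaler_sumr -big_split;
  apply: eq_bigr => p _ /=; rewrite mulrDl -scalerAl ?linearPl ?linearPr.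
Qed.

Definition tensor_prod x y : A ⊗[k] B :=
  \sw_(a ⊗ b <- x) \sw_(c ⊗ d <- y) (a * c) ⊗ (b * d).

Lemma tensor_prodPl y : linear (tensor_prod^~ y).
Proof. exact: tensor_sw_linear (tensor_prod_bilinear2 y). Qed.

Lemma tensor_prodPr x : linear (tensor_prod x).
Proof.
move=> e y z; rewrite /tensor_prod {1 3 5}/tensor_sw scaler_sumr -big_split.
apply: eq_bigr => p _; exact: (tensor_sw_linear (tensor_prod_bilinear1 p.1 p.2)).
Qed.

HB.instance Definition _ := bilinear_isBilinear.Build k _ _ _ *:%R *:%R
  tensor_prod (tensor_prodPl, tensor_prodPr).

Lemma tensor_prod_tens a b c d :
  tensor_prod (a ⊗ b) (c ⊗ d) = (a * c) ⊗ (b * d).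
Proof.
rewrite /tensor_prod (tensor_sw_tens _ _ (tensor_prod_bilinear2 _)).
exact: tensor_sw_tens (tensor_prod_bilinear1 a b).
Qed.

Lemma tensor_prodDl : left_distributive tensor_prod +%R.
Proof. by move=> x y z; rewrite linearDl. Qed.

Lemma tensor_prodDr : right_distributive tensor_prod +%R.
Proof. by move=> x y z; rewrite linearDr. Qed.

Lemma tensor_prod0l : left_zero 0 tensor_prod.
Proof. by move=> x; rewrite linear0l. Qed.

Lemma tensor_prod0r : right_zero 0 tensor_prod.
Proof. by move=> x; rewrite linear0r. Qed.

Lemma tensor_prodA : associative tensor_prod.
Proof.
elim/tensor_ind=> [|a b x IHx] y z; first by rewrite !tensor_prod0l.
rewrite !tensor_prodDl IHx; congr (_ + _) => {x IHx}.
elim/tensor_ind: y => [|c d y IHy].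
  by rewrite tensor_prod0r !tensor_prod0l tensor_prod0r.
rewrite !(tensor_prodDl, tensor_prodDr) IHy; congr (_ + _) => {y IHy}.
elim/tensor_ind: z => [|e f z IHz]; first by rewrite !tensor_prod0r.
by rewrite !tensor_prodDr IHz !tensor_prod_tens !mulrA.
Qed.

Lemma tensor_prod1l : left_id (1 ⊗ 1) tensor_prod.
Proof.
elim/tensor_ind=> [|a b x IHx]; first by rewrite tensor_prod0r.
by rewrite tensor_prodDr IHx tensor_prod_tens !mul1r.
Qed.

Lemma tensor_prod1r : right_id (1 ⊗ 1) tensor_prod.
Proof.
elim/tensor_ind=> [|a b x IHx]; first by rewrite tensor_prod0l.
by rewrite tensor_prodDl IHx tensor_prod_tens !mulr1.
Qed.

HB.instance Definition _ := GRing.Zmodule_isPzRing.Build (A ⊗[k] B)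
  tensor_prodA tensor_prod1l tensor_prod1r tensor_prodDl tensor_prodDr.

Lemma tensor_scalerAl c x y : c *: (x * y) = c *: x * y.
Proof. by rewrite [RHS]linearZl_LR. Qed.

Lemma tensor_scalerAr c x y : c *: (x * y) = x * (c *: y).
Proof. by rewrite [RHS]linearZr_LR. Qed.

Definition tensor_aug (t : A ⊗[k] B) : k :=
  \sw_(a ⊗ b <- t) (@aug k A a * @aug k B b : k^o).

Lemma tensor_aug_bilinear :
  bilinear_for *:%R *:%R (fun (a : A) (b : B) => @aug k A a * @aug k B b : k^o).
Proof.
split=> [b c a a'|a c b b'] /=; rewrite linearP ?mulrDl ?mulrDr /=.
  by rewrite -mulrA.
by rewrite mulrCA.
Qed.

Lemma tensor_aug_linear : scalar tensor_aug.
Proof. exact: tensor_sw_linear tensor_aug_bilinear. Qed.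

HB.instance Definition _ := GRing.isLinear.Build k _ k *%R
  tensor_aug tensor_aug_linear.

Lemma tensor_augE a b : tensor_aug (a ⊗ b) = aug a * aug b.
Proof. exact: (@tensor_sw_tens _ _ _ k^o _ _ _ tensor_aug_bilinear). Qed.

Lemma tensM (a c : A) (b d : B) : (a ⊗ b) * (c ⊗ d) = (a * c) ⊗ (b * d).
Proof. exact: tensor_prod_tens. Qed.

Lemma tens1 : 1 ⊗ 1 = 1 :> A ⊗[k] B. Proof. by []. Qed.

Lemma tensor_aug_monoid_morphism : monoid_morphism tensor_aug.
Proof.
split=> [|x y]; first by rewrite -tens1 tensor_augE !rmorph1 mulr1.
elim/tensor_ind: x => [|a b x IHx]; first by rewrite mul0r linear0 mul0r.
rewrite mulrDl !linearD /= mulrDl IHx; congr (_ + _) => {x IHx}.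
elim/tensor_ind: y => [|c d y IHy]; first by rewrite mulr0 linear0 mulr0.
rewrite mulrDr !linearD /= mulrDr IHy tensM !tensor_augE !rmorphM.
by rewrite mulrACA.
Qed.

(** The product of the augmentations sends 1 to 1 and 0 to 0. For general nonzero algebras the claim
    can fail: over the integers, Z/2 ⊗ Z/3 = 0. *)
Lemma tensor_one_neq0 : 1 != 0 :> A ⊗[k] B.
Proof.
apply/eqP=> /(congr1 tensor_aug)/eqP.
by rewrite tensor_aug_monoid_morphism.1 linear0 oner_eq0.
Qed.

HB.instance Definition _ :=
  GRing.PzSemiRing_isNonZero.Build (A ⊗[k] B) tensor_one_neq0.
HB.instance Definition _ :=
  GRing.Lmodule_isLalgebra.Build k (A ⊗[k] B) tensor_scalerAl.
HB.instance Definition _ :=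
  GRing.Lalgebra_isAlgebra.Build k (A ⊗[k] B) tensor_scalerAr.
HB.instance Definition _ := hasAugmentation.Build k (A ⊗[k] B)
  tensor_aug_linear tensor_aug_monoid_morphism.

End TensorAlgebra.

(** * Algebra morphisms between tensor products *)

Section AlgebraMorphisms.
Context {k : comNzRingType}.
Implicit Types A B C : augAlgType k.

Lemma tensor_monoid_morphism A B C (f : {linear A ⊗[k] B -> C}) :
    f (1 ⊗ 1) = 1 ->
    (forall a b c d, f ((a * c) ⊗ (b * d)) = f (a ⊗ b) * f (c ⊗ d)) ->
  monoid_morphism f.
Proof.
move=> f1 fM; split=> // x y.
elim/tensor_ind: x => [|a b x IHx]; first by rewrite mul0r linear0 mul0r.
rewrite mulrDl !linearD /= mulrDl IHx; congr (_ + _) => {x IHx}.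
elim/tensor_ind: y => [|c d y IHy]; first by rewrite mulr0 linear0 mulr0.
by rewrite mulrDr !linearD /= mulrDr IHy tensM fM.
Qed.

Section Map.
Variables (A A' B B' : augAlgType k).
Variables (f : {lrmorphism A -> A'}) (g : {lrmorphism B -> B'}).

Lemma tensor_map_monoid_morphism : monoid_morphism (tensor_map f g).
Proof.
apply: tensor_monoid_morphism => [|a b c d]; rewrite /= !tensor_mapE /=.
  by rewrite !rmorph1.
by rewrite !rmorphM tensM.
Qed.

HB.instance Definition _ := GRing.isMonoidMorphism.Build _ _ (tensor_map f g)
  tensor_map_monoid_morphism.
End Map.

Lemma tensor_flip_monoid_morphism A B : monoid_morphism (@tensor_flip k A B).
Proof.
apply: tensor_monoid_morphism => [|a b c d]; rewrite /= !tensor_flipE //.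
by rewrite tensM.
Qed.

HB.instance Definition _ A B := GRing.isMonoidMorphism.Build _ _
  (@tensor_flip k A B) (tensor_flip_monoid_morphism A B).

(** Multiplicativity is bilinear in x and y, and the left factors are themselves tensors, hence four
    nested inductions down to pure tensors. *)
Lemma tensor_assoc_monoid_morphism A B C : monoid_morphism (@tensor_assoc k A B C).
Proof.
split=> [|x y]; first by rewrite -!tens1 tensor_assocE.
elim/tensor_ind: x => [|u c x IHx]; first by rewrite mul0r linear0 mul0r.
rewrite mulrDl !linearD /= mulrDl IHx; congr (_ + _) => {x IHx}.
elim/tensor_ind: y => [|v d y IHy]; first by rewrite mulr0 linear0 mulr0.
rewrite mulrDr !linearD /= mulrDr IHy tensM; congr (_ + _) => {y IHy}.
elim/tensor_ind: u => [|a b u IHu].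
  by rewrite mul0r !linear0l linear0 mul0r.
rewrite mulrDl !linearDl !linearD /= mulrDl IHu; congr (_ + _) => {u IHu}.
elim/tensor_ind: v => [|a' b' v IHv].
  by rewrite mulr0 !linear0l linear0 mulr0.
rewrite mulrDr !linearDl !linearD /= mulrDr IHv; congr (_ + _) => {v IHv}.
by rewrite tensM !tensor_assocE !tensM.
Qed.

HB.instance Definition _ A B C := GRing.isMonoidMorphism.Build _ _
  (@tensor_assoc k A B C) (tensor_assoc_monoid_morphism A B C).

Section Inclusions.
Variables A B : augAlgType k.

Definition tens_inl (a : A) : A ⊗[k] B := a ⊗ 1.
Definition tens_inr (b : B) : A ⊗[k] B := 1 ⊗ b.

Lemma tens_inl_linear : linear tens_inl.
Proof. by move=> c a a'; rewrite /tens_inl linearPl. Qed.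

Lemma tens_inr_linear : linear tens_inr.
Proof. by move=> c b b'; rewrite /tens_inr linearPr. Qed.

Lemma tens_inl_monoid_morphism : monoid_morphism tens_inl.
Proof. by split=> // a b; rewrite /tens_inl tensM mulr1. Qed.

Lemma tens_inr_monoid_morphism : monoid_morphism tens_inr.
Proof. by split=> // a b; rewrite /tens_inr tensM mulr1. Qed.

HB.instance Definition _ := GRing.isLinear.Build k _ _ _ tens_inl tens_inl_linear.
HB.instance Definition _ := GRing.isLinear.Build k _ _ _ tens_inr tens_inr_linear.
HB.instance Definition _ := GRing.isMonoidMorphism.Build _ _ tens_inl
  tens_inl_monoid_morphism.
HB.instance Definition _ := GRing.isMonoidMorphism.Build _ _ tens_inr
  tens_inr_monoid_morphism.

(** With ε = [aug], these are ε ⊗ id and id ⊗ ε. They express the counit axioms and the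
    normalisation of a twist, and their multiplicativity makes both usable on products. *)
Definition aug_left (t : A ⊗[k] B) : B := \sw_(a ⊗ b <- t) aug a *: b.
Definition aug_right (t : A ⊗[k] B) : A := \sw_(a ⊗ b <- t) aug b *: a.

Lemma aug_left_bilinear :
  bilinear_for *:%R *:%R (fun (a : A) (b : B) => aug a *: b).
Proof.
split=> [b c a a'|a c b b'] /=; first by rewrite linearP scalerDl scalerA.
by rewrite scalerDr !scalerA mulrC.
Qed.

Lemma aug_right_bilinear :
  bilinear_for *:%R *:%R (fun (a : A) (b : B) => aug b *: a).
Proof.
split=> [b c a a'|a c b b'] /=; first by rewrite scalerDr !scalerA mulrC.
by rewrite linearP scalerDl scalerA.
Qed.

HB.instance Definition _ := GRing.isLinear.Build k _ _ _ aug_left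
  (tensor_sw_linear aug_left_bilinear).
HB.instance Definition _ := GRing.isLinear.Build k _ _ _ aug_right
  (tensor_sw_linear aug_right_bilinear).

Lemma aug_leftE a b : aug_left (a ⊗ b) = aug a *: b.
Proof. exact: tensor_sw_tens aug_left_bilinear. Qed.

Lemma aug_rightE a b : aug_right (a ⊗ b) = aug b *: a.
Proof. exact: tensor_sw_tens aug_right_bilinear. Qed.

Lemma aug_left_monoid_morphism : monoid_morphism aug_left.
Proof.
apply: tensor_monoid_morphism => [|a b c d]; rewrite /= !aug_leftE.
  by rewrite rmorph1 scale1r.
by rewrite rmorphM -scalerAl -scalerAr scalerA.
Qed.

Lemma aug_right_monoid_morphism : monoid_morphism aug_right.
Proof.
apply: tensor_monoid_morphism => [|a b c d]; rewrite /= !aug_rightE.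
  by rewrite rmorph1 scale1r.
by rewrite rmorphM -scalerAl -scalerAr scalerA.
Qed.

HB.instance Definition _ := GRing.isMonoidMorphism.Build _ _ aug_left
  aug_left_monoid_morphism.
HB.instance Definition _ := GRing.isMonoidMorphism.Build _ _ aug_right
  aug_right_monoid_morphism.
End Inclusions.

End AlgebraMorphisms.

(** * Drinfeld twists of ordinary bialgebras *)

Section Twist.
Context {k : comNzRingType}.
Variable A : augAlgType k.
Local Notation A2 := (A ⊗[k] A).
Local Notation A3 := (A ⊗[k] (A ⊗[k] A)).
Local Notation flip := (@tensor_flip k A A).

Lemma tensor3_ext (P : lmodType k) (f g : {linear A3 -> P}) :
  (forall a b c, f (a ⊗ (b ⊗ c)) = g (a ⊗ (b ⊗ c))) -> f =1 g.
Proof.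
move=> fg; apply: tensor_ext => a; elim/tensor_ind=> [|b c t IHt].
  by rewrite linear0r !linear0.
by rewrite linearDr !linearD fg IHt.
Qed.

Arguments tensor3_ext [P] f g.

(** * Leg embeddings X_12, X_13, X_23 and permutations of the three factors *)

Definition leg12 : A2 -> A3 := tensor_map idfun (@tens_inl k A A).
Definition leg13 : A2 -> A3 := tensor_map idfun (@tens_inr k A A).
Definition leg23 : A2 -> A3 := @tens_inr k A A2.
Definition swap23 : A3 -> A3 := tensor_map idfun flip.
Definition rot : A3 -> A3 := @tensor_assoc k A A A \o @tensor_flip k A A2.
Definition swap12 : A3 -> A3 := swap23 \o rot.
HB.instance Definition _ := GRing.LRMorphism.on leg12.
HB.instance Definition _ := GRing.LRMorphism.on leg13.
HB.instance Definition _ := GRing.LRMorphism.on leg23.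
HB.instance Definition _ := GRing.LRMorphism.on swap23.
HB.instance Definition _ := GRing.LRMorphism.on rot.
HB.instance Definition _ := GRing.LRMorphism.on swap12.

Lemma leg12E a b : leg12 (a ⊗ b) = a ⊗ (b ⊗ 1). Proof. exact: tensor_mapE. Qed.
Lemma leg13E a b : leg13 (a ⊗ b) = a ⊗ (1 ⊗ b). Proof. exact: tensor_mapE. Qed.
Lemma leg23E t : leg23 t = 1 ⊗ t. Proof. by []. Qed.
Lemma swap23E a t : swap23 (a ⊗ t) = a ⊗ tensor_flip t.
Proof. exact: tensor_mapE. Qed.
Lemma rotE a b c : rot (a ⊗ (b ⊗ c)) = b ⊗ (c ⊗ a).
Proof. by rewrite /rot /= tensor_flipE tensor_assocE. Qed.
Lemma swap12E a b c : swap12 (a ⊗ (b ⊗ c)) = b ⊗ (a ⊗ c).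
Proof. by rewrite /swap12 /= rotE swap23E tensor_flipE. Qed.

Variable D : {lrmorphism A -> A2}.

(* [comulr] is id ⊗ D and [comull] is D ⊗ id, rebracketed to the right. *)
Definition comulr : A2 -> A3 := tensor_map idfun D.
Definition comull : A2 -> A3 := @tensor_assoc k A A A \o tensor_map D idfun.
HB.instance Definition _ := GRing.LRMorphism.on comulr.
HB.instance Definition _ := GRing.LRMorphism.on comull.

Lemma comulrE a b : comulr (a ⊗ b) = a ⊗ D b. Proof. exact: tensor_mapE. Qed.
Lemma comullE a b : comull (a ⊗ b) = tensor_assoc (D a ⊗ b).
Proof. by rewrite /comull /= tensor_mapE. Qed.

Lemma rot_leg12 t : rot (leg12 t) = leg13 (tensor_flip t).
Proof.
move: t; apply: (tensor_ext (rot \o leg12) (leg13 \o flip)) => a b /=.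
by rewrite leg12E rotE tensor_flipE leg13E.
Qed.

Lemma rot_leg13 t : rot (leg13 t) = leg23 (tensor_flip t).
Proof.
move: t; apply: (tensor_ext (rot \o leg13) (leg23 \o flip)) => a b /=.
by rewrite leg13E rotE tensor_flipE leg23E.
Qed.

Lemma rot_leg23 t : rot (leg23 t) = leg12 t.
Proof.
move: t; apply: (tensor_ext (rot \o leg23) leg12) => a b /=.
by rewrite leg23E rotE leg12E.
Qed.

Lemma swap23_leg12 t : swap23 (leg12 t) = leg13 t.
Proof.
move: t; apply: (tensor_ext (swap23 \o leg12) leg13) => a b /=.
by rewrite leg12E swap23E tensor_flipE leg13E.
Qed.

Lemma swap23_leg23 t : swap23 (leg23 t) = leg23 (tensor_flip t).
Proof. by rewrite !leg23E swap23E. Qed.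

Lemma swap12_leg12 t : swap12 (leg12 t) = leg12 (tensor_flip t).
Proof.
move: t; apply: (tensor_ext (swap12 \o leg12) (leg12 \o flip)) => a b /=.
by rewrite leg12E swap12E tensor_flipE leg12E.
Qed.

Lemma swap12_leg23 t : swap12 (leg23 t) = leg13 t.
Proof. by rewrite /swap12 /= rot_leg23 swap23_leg12. Qed.

Lemma rot_comulr t : rot (comulr t) = comull (tensor_flip t).
Proof.
move: t; apply: (tensor_ext (rot \o comulr) (comull \o flip)) => a b /=.
by rewrite comulrE tensor_flipE comullE /rot /= tensor_flipE.
Qed.

Lemma rot_rot_comull t : rot (rot (comull t)) = comulr (tensor_flip t).
Proof.
move: t; apply: (tensor_ext (rot \o (rot \o comull)) (comulr \o flip)) => a b /=.
rewrite tensor_flipE comulrE comullE.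
(* [D a] is not a pure tensor, so [rotE] applies only after a second induction, over [D a]. *)
elim/tensor_ind: (D a) => [|c d t IHt]; first by rewrite linear0l linear0r !linear0.
by rewrite linearDl linearDr !linearD /= IHt tensor_assocE !rotE.
Qed.

Lemma rot_swap12 t : rot (swap12 t) = swap23 t.
Proof.
move: t; apply: (tensor3_ext (rot \o swap12) swap23) => a b c /=.
by rewrite swap12E rotE swap23E tensor_flipE.
Qed.

Lemma rot_rot_swap23 t : rot (rot (swap23 t)) = swap12 t.
Proof.
move: t; apply: (tensor3_ext (rot \o (rot \o swap23)) swap12) => a b c /=.
by rewrite swap12E swap23E tensor_flipE !rotE.
Qed.

Lemma leg12_assoc t : leg12 t = tensor_assoc (t ⊗ 1).
Proof.
move: t; apply: (tensor_ext _ (@tensor_assoc k A A A \o @tens_inl k A2 A)) => a b.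
by rewrite /= leg12E tensor_assocE.
Qed.

Lemma swap12_assoc u a :
  swap12 (tensor_assoc (u ⊗ a)) = tensor_assoc (tensor_flip u ⊗ a).
Proof.
elim/tensor_ind: u => [|c d u IHu]; first by rewrite linear0 !linear0l !linear0.
rewrite linearDl !linearD /= linearDl linearD /= IHu.
by rewrite tensor_flipE !tensor_assocE swap12E.
Qed.

(** * Moving an R-matrix past a comultiplied pair of legs *)

Section Intertwine.
Variable R : A2.

Lemma leg12_comull :
    (forall x, R * D x = tensor_flip (D x) * R) ->
  forall t, leg12 R * comull t = swap12 (comull t) * leg12 R.
Proof.
move=> RD; elim/tensor_ind=> [|a b t IHt]; first by rewrite !linear0 mulr0 mul0r.
rewrite !linearD /= mulrDr mulrDl IHt comullE swap12_assoc leg12_assoc.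
by rewrite -!rmorphM /= !tensM RD mulr1 mul1r.
Qed.

(** The hypothesis is the one satisfied by the flipped R-matrix R_21, to which this lemma is
    applied. *)
Lemma comull_leg12 :
    (forall x, D x * R = R * tensor_flip (D x)) ->
  forall t, comull t * leg12 R = leg12 R * swap12 (comull t).
Proof.
move=> RD; elim/tensor_ind=> [|a b t IHt]; first by rewrite !linear0 mulr0 mul0r.
rewrite !linearD /= mulrDr mulrDl IHt comullE swap12_assoc leg12_assoc.
by rewrite -!rmorphM /= !tensM RD mulr1 mul1r.
Qed.

Lemma leg23_comulr :
    (forall x, R * D x = tensor_flip (D x) * R) ->
  forall t, leg23 R * comulr t = swap23 (comulr t) * leg23 R.
Proof.
move=> RD; elim/tensor_ind=> [|a b t IHt]; first by rewrite !linear0 mulr0 mul0r.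
rewrite !linearD /= mulrDr mulrDl IHt comulrE swap23E leg23E.
by rewrite !tensM RD mulr1 mul1r.
Qed.

Lemma comulr_leg23 :
    (forall x, D x * R = R * tensor_flip (D x)) ->
  forall t, comulr t * leg23 R = leg23 R * swap23 (comulr t).
Proof.
move=> RD; elim/tensor_ind=> [|a b t IHt]; first by rewrite !linear0 mulr0 mul0r.
rewrite !linearD /= mulrDr mulrDl IHt comulrE swap23E leg23E.
by rewrite !tensM RD mulr1 mul1r.
Qed.
End Intertwine.

(** * The twisted comultiplication and its R-matrix *)

Section Twisted.
Variables F G : A2.
Hypotheses (FG : F * G = 1) (GF : G * F = 1).
Hypothesis cocycle : leg23 F * comulr F = leg12 F * comull F.

Definition twist (x : A) : A2 := F * D x * G.

Lemma twist_linear : linear twist.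
Proof.
by move=> c x y; rewrite /twist linearP mulrDr mulrDl -scalerAr -scalerAl.
Qed.

HB.instance Definition _ := GRing.isLinear.Build k _ _ _ twist twist_linear.

Lemma twistM x y : twist (x * y) = twist x * twist y.
Proof. by rewrite /twist rmorphM !mulrA -(mulrA _ G F) GF mulr1. Qed.

Lemma twist1 : twist 1 = 1.
Proof. by rewrite /twist rmorph1 mulr1. Qed.

(** Conjugation inside two legs becomes multiplication by F_23 and G_23 from outside, so identities
    for D^F turn into identities between products in A ⊗ A ⊗ A. *)
Lemma twistr t : tensor_map idfun twist t = leg23 F * comulr t * leg23 G.
Proof.
elim/tensor_ind: t => [|a b t IHt]; first by rewrite !linear0 mulr0 mul0r.
rewrite !linearD /= mulrDr mulrDl IHt tensor_mapE comulrE !leg23E !tensM.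
by rewrite mulr1 mul1r.
Qed.

Lemma twistl t :
  tensor_assoc (tensor_map twist idfun t) = leg12 F * comull t * leg12 G.
Proof.
elim/tensor_ind: t => [|a b t IHt]; first by rewrite !linear0 mulr0 mul0r.
rewrite !linearD /= mulrDr mulrDl IHt tensor_mapE comullE !leg12_assoc.
by rewrite -!rmorphM !tensM mulr1 mul1r.
Qed.

Lemma morph_FG (B : augAlgType k) (f : {lrmorphism A2 -> B}) : f F * f G = 1.
Proof. by rewrite -rmorphM FG rmorph1. Qed.

Lemma morph_GF (B : augAlgType k) (f : {lrmorphism A2 -> B}) : f G * f F = 1.
Proof. by rewrite -rmorphM GF rmorph1. Qed.

(** The two sides are the inverses of the two sides of [cocycle]. *)
Lemma cocycle_inv : comulr G * leg23 G = comull G * leg12 G.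
Proof.
rewrite -[LHS]mulr1 -(morph_FG leg12) /= -(mulr1 (leg12 F)) -(morph_FG comull) /=.
rewrite (mulrA (leg12 F)) -cocycle -!mulrA (mulrA (leg23 G)) morph_GF mul1r.
by rewrite (mulrA (comulr G)) morph_GF mul1r.
Qed.

(** Multiply [cocycle] by G_12 on the left and by (id ⊗ D) G on the right. *)
Lemma cocycle_mixed : leg12 G * leg23 F = comull F * comulr G.
Proof.
rewrite -[LHS]mulr1 -(morph_FG comulr) !mulrA -(mulrA _ (leg23 F)) cocycle.
by rewrite mulrA morph_GF mul1r.
Qed.

(** Each side is a product of three blocks: the F-blocks agree by [cocycle], the middle ones by
    coassociativity of D, and the G-blocks by [cocycle_inv]. *)
Lemma twist_coassoc : (forall x, comulr (D x) = comull (D x)) ->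
  forall x, tensor_map idfun twist (twist x) =
            tensor_assoc (tensor_map twist idfun (twist x)).
Proof.
move=> DA x; rewrite twistr twistl /twist !rmorphM /= !mulrA cocycle DA.
by rewrite -!mulrA cocycle_inv.
Qed.

(** The algebra morphism [aug_left] sends F to 1, hence also its inverse G. *)
Lemma twist_aug_left : (forall x, aug_left (D x) = x) -> aug_left F = 1 ->
  forall x, aug_left (twist x) = x.
Proof.
move=> D1 F1 x; have := morph_FG (@aug_left k A A); rewrite /= F1 mul1r => G1.
by rewrite /twist !rmorphM /= F1 G1 D1 mulr1 mul1r.
Qed.

Lemma twist_aug_right : (forall x, aug_right (D x) = x) -> aug_right F = 1 ->
  forall x, aug_right (twist x) = x.
Proof.
move=> D1 F1 x; have := morph_FG (@aug_right k A A); rewrite /= F1 mul1r => G1.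
by rewrite /twist !rmorphM /= F1 G1 D1 mulr1 mul1r.
Qed.

Variable R : A2.
Hypothesis RD : forall x, R * D x = tensor_flip (D x) * R.

Definition twist_R : A2 := tensor_flip F * R * G.

Lemma twist_R_comul x : twist_R * twist x = tensor_flip (twist x) * twist_R.
Proof.
rewrite /twist_R /twist !rmorphM /= !mulrA -(mulrA _ G F) GF mulr1.
rewrite -(mulrA _ (tensor_flip G) (tensor_flip F)) morph_GF mulr1.
by rewrite -(mulrA _ R) RD !mulrA.
Qed.

Lemma twist_R_inv S : R * S = 1 -> S * R = 1 ->
  twist_R * (F * S * tensor_flip G) = 1 /\ (F * S * tensor_flip G) * twist_R = 1.
Proof.
move=> RS SR; rewrite /twist_R; split.
  by rewrite !mulrA -(mulrA _ G F) GF mulr1 -(mulrA _ R S) RS mulr1 morph_FG.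
rewrite !mulrA -(mulrA _ (tensor_flip G)) morph_GF mulr1.
by rewrite -(mulrA _ S R) SR mulr1.
Qed.

(** This is [RD] with the two tensor factors exchanged. *)
Let flip_RD x : D x * tensor_flip R = tensor_flip R * tensor_flip (D x).
Proof. by rewrite -[D x in LHS]tensor_flipK -!rmorphM /= -RD rmorphM. Qed.

(** The left side expands to F_12 (D ⊗ id)(F_21) R_13 R_23 (D ⊗ id)(G) G_12, and the goal is F_31
    R_13 G_13 F_32 R_23 G_23. *)
Lemma twist_R_comull : comull R = leg13 R * leg23 R ->
  tensor_assoc (tensor_map twist idfun twist_R) = leg13 twist_R * leg23 twist_R.
Proof.
move=> DR.
(* The cyclic permutation [rot] of [cocycle]: it carries F_23 to F_12, F_12 to F_31 and (id ⊗ D) F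
   to (D ⊗ id)(F_21). *)
have C1 : leg12 F * comull (tensor_flip F) =
          leg13 (tensor_flip F) * rot (comull F).
  by rewrite -rot_leg23 -rot_comulr -rmorphM cocycle rmorphM /= rot_leg12.
(* [cocycle_mixed] with the last two factors exchanged. *)
have C2 : swap23 (comull F) * swap23 (comulr G) =
          leg13 G * leg23 (tensor_flip F).
  by rewrite -rmorphM -cocycle_mixed rmorphM /= swap23_leg12 swap23_leg23.
(* Rotate the intertwining relation of R_21 in legs 1 and 2; [rot] carries that copy of R_21 to
   R_13. *)
have RF : rot (comull F) * leg13 R = leg13 R * swap23 (comull F).
  have := congr1 rot (comull_leg12 flip_RD F).
  by rewrite !rmorphM /= rot_leg12 tensor_flipK rot_swap12.
rewrite twistl /twist_R !rmorphM /= DR !mulrA C1 -(mulrA _ _ (leg13 R)) RF.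
(* [cocycle_inv] trades (D ⊗ id)(G) G_12 for (id ⊗ D)(G) G_23. Then R_23 passes (id ⊗ D) G by [RD],
   which creates the left side of [C2]. *)
rewrite -(mulrA _ (comull G)) -cocycle_inv !mulrA -(mulrA _ (leg23 R)).
by rewrite (leg23_comulr RD) !mulrA -(mulrA _ (swap23 (comull F))) C2 !mulrA.
Qed.

(** The mirror image of [twist_R_comull], with [rot] applied twice instead of once and [swap12]
    instead of [swap23]; the goal reads F_31 R_13 G_13 F_21 R_12 G_12. *)
Lemma twist_R_comulr : comulr R = leg13 R * leg12 R ->
  tensor_map idfun twist twist_R = leg13 twist_R * leg12 twist_R.
Proof.
move=> DR.
have C1 : leg23 F * comulr (tensor_flip F) =
          leg13 (tensor_flip F) * rot (rot (comulr F)).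
  rewrite -[leg23 F](congr1 leg23 (tensor_flipK F)) -rot_leg13.
  rewrite -rot_leg12 -rot_rot_comull -!rmorphM -cocycle !rmorphM /=.
  by rewrite rot_leg23 rot_leg12.
have C2 : swap12 (comulr F) * swap12 (comull G) =
          leg13 G * leg12 (tensor_flip F).
  (* The other mixed form: [cocycle] multiplied by G_23 on the left and by (D ⊗ id) G on the
     right. *)
  have mixed : leg23 G * leg12 F = comulr F * comull G.
    rewrite -[LHS]mulr1 -(morph_FG comull) !mulrA -(mulrA _ (leg12 F)) -cocycle.
    by rewrite mulrA morph_GF mul1r.
  by rewrite -rmorphM -mixed rmorphM /= swap12_leg12 swap12_leg23.
have RF : rot (rot (comulr F)) * leg13 R = leg13 R * swap12 (comulr F).
  have := congr1 (rot \o rot) (comulr_leg23 flip_RD F).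
  by rewrite /= !rmorphM /= rot_leg23 rot_leg12 tensor_flipK rot_rot_swap23.
rewrite twistr /twist_R !rmorphM /= DR !mulrA C1 -(mulrA _ _ (leg13 R)) RF.
rewrite -(mulrA _ (comulr G)) cocycle_inv !mulrA -(mulrA _ (leg12 R)).
by rewrite (leg12_comull RD) !mulrA -(mulrA _ (swap12 (comulr F))) C2 !mulrA.
Qed.
End Twisted.

End Twist.

(** * From monoidal Hom-bialgebras to ordinary bialgebras and back *)

Section Sweedler.
Context {k : comNzRingType}.

Lemma linear_sw (M N P Q : lmodType k) (g : {linear P -> Q}) (f : M -> N -> P) t :
  g (\sw_(a ⊗ b <- t) f a b) = \sw_(a ⊗ b <- t) g (f a b).
Proof. exact: linear_sum. Qed.

Lemma eq_sw (M N : lmodType k) (P : nmodType) (f g : M -> N -> P) t :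
  (forall a b, f a b = g a b) -> \sw_(a ⊗ b <- t) f a b = \sw_(a ⊗ b <- t) g a b.
Proof. by move=> fg; apply: eq_bigr => p _; apply: fg. Qed.

Lemma tensor_assoc_tens (M N P : lmodType k) (u : M ⊗[k] N) (c : P) :
  tensor_assoc (u ⊗ c) = \sw_(a ⊗ b <- u) a ⊗ (b ⊗ c).
Proof. exact: tensor_sw_tens (tensor_assoc_bilinear2 _ _ _). Qed.

Lemma tensor_assoc_map (M N P Q S : lmodType k) (f : M -> P ⊗[k] Q) (g : N -> S) t :
  tensor_assoc (tensor_map f g t) =
  \sw_(a ⊗ b <- t) \sw_(a1 ⊗ a2 <- f a) a1 ⊗ (a2 ⊗ g b).
Proof. by rewrite linear_sw; apply: eq_sw => a b; apply: tensor_assoc_tens. Qed.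

Variable A : augAlgType k.
Local Notation A2 := (A ⊗[k] A).

(** This product and the next are, for x = y = R, the right sides of the ordinary hexagon identities
    in Sweedler form. *)
Lemma leg13_leg23 (x y : A2) : leg13 x * leg23 y =
  \sw_(a ⊗ b <- x) \sw_(c ⊗ d <- y) a ⊗ (c ⊗ (b * d)).
Proof.
rewrite mulr_suml; apply: eq_bigr => p _.
rewrite leg23E [y in LHS]tensor_decomp linear_sumr mulr_sumr.
by apply: eq_bigr => q _; rewrite /= !tensM mulr1 mul1r.
Qed.

Lemma leg13_leg12 (x y : A2) : leg13 x * leg12 y =
  \sw_(a ⊗ b <- x) \sw_(c ⊗ d <- y) (a * c) ⊗ (d ⊗ b).
Proof.
rewrite mulr_suml; apply: eq_bigr => p _; rewrite mulr_sumr.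
by apply: eq_bigr => q _; rewrite /= !tensM mulr1 mul1r.
Qed.

End Sweedler.

(** * Ordinary and Hom-structures related by the automorphism [al] *)

Section HomTwist.
Context {k : comNzRingType}.
Variable A : augAlgType k.
Local Notation A2 := (A ⊗[k] A).
Local Notation A3 := (A ⊗[k] (A ⊗[k] A)).
Variables (al : {lrmorphism A -> A}) (ai : {linear A -> A}).
Hypotheses (alK : cancel al ai) (aiK : cancel ai al).
Hypothesis aug_al : forall x, aug (al x) = aug x.
Variables (m : A2 -> A) (eta : k^o -> A).
Hypotheses (m_linear : linear m) (mE : forall a b, m (a ⊗ b) = al (a * b)).
Hypotheses (eta_linear : linear eta) (eta1 : eta 1 = 1).
Local Notation al2 := (tensor_map al al).

Lemma tensor_mulE x y : tensor_mul m x y = al2 (x * y).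
Proof.
have -> : x * y = \sw_(a ⊗ b <- x) \sw_(c ⊗ d <- y) (a * c) ⊗ (b * d) by [].
rewrite linear_sw; apply: eq_sw => a b; rewrite linear_sw; apply: eq_sw => c d.
by rewrite /= tensor_mapE !mE.
Qed.

Local Notation al3 := (tensor_map al al2).

Lemma al3_tensor_assoc t :
  al3 (tensor_assoc t) = tensor_assoc (tensor_map al2 al t) :> A3.
Proof.
move: t; apply: (tensor_ext (al3 \o @tensor_assoc k A A A)
  (@tensor_assoc k A A A \o tensor_map al2 al)) => u c /=.
elim/tensor_ind: u => [|a b u IHu]; first by rewrite !(linear0l, linear0).
rewrite linearDl !linearD /= IHu tensor_assocE !tensor_mapE /= !tensor_mapE.
by rewrite tensor_assocE.
Qed.

(* The Yau twist along [al] of the bialgebra with comultiplication [T]. *)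
Section Structure.
Variable T : {linear A -> A2}.
Hypothesis T_al : forall x, T (al x) = al2 (T x).
Hypotheses (TM : forall x y, T (x * y) = T x * T y) (T1 : T 1 = 1).
Hypothesis TA : forall x,
  tensor_map idfun T (T x) = tensor_assoc (tensor_map T idfun (T x)).
Hypotheses (T_aug_left : forall x, aug_left (T x) = x).
Hypotheses (T_aug_right : forall x, aug_right (T x) = x).
Local Notation Delta := (fun x => T (al x)).

(** As T commutes with [al], the copies of [al] in a Hom-axiom collect into one outer automorphism,
    leaving the ordinary axiom underneath. *)
Lemma tensor_map_al_T t :
  tensor_map al Delta t = al3 (tensor_map idfun T t).
Proof.
move: t; apply: (tensor_ext (tensor_map al (T \o al))
  (al3 \o tensor_map idfun T)) => a b.
by rewrite /= !tensor_mapE /= T_al.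
Qed.

Lemma tensor_map_T_al t :
  tensor_map Delta al t = tensor_map al2 al (tensor_map T idfun t).
Proof.
move: t; apply: (tensor_ext (tensor_map (T \o al) al)
  (tensor_map al2 al \o tensor_map T idfun)) => a b.
by rewrite /= !tensor_mapE /= T_al.
Qed.

Lemma hom_bialgebra : is_Hom_bialgebra al m eta Delta (@aug k A).
Proof.
split; split=> //.
- exact: linearP.
- by move=> a b; rewrite !mE !rmorphM.
- by move=> a b c; rewrite !mE !rmorphM mulrA.
- by rewrite eta1 rmorph1.
- by move=> a; rewrite mE eta1 mul1r.
- by move=> a; rewrite mE eta1 mulr1.
- exact: linearP.
- by move=> c x y; rewrite !linearP.
- exact: aug_linear.
- move=> c; rewrite -[LHS]/(tensor_map al Delta (Delta c)) -tensor_assoc_map.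
  by rewrite tensor_map_al_T TA al3_tensor_assoc tensor_map_T_al.
- by move=> c; rewrite -[LHS]/(aug_left (Delta c)) T_aug_left.
- by move=> c; rewrite -[LHS]/(aug_right (Delta c)) T_aug_right.
- by move=> a b; rewrite mE tensor_mulE -TM -T_al rmorphM.
- by rewrite eta1 rmorph1 T1 /tensor_one eta1.
- by move=> a b; rewrite mE aug_al rmorphM.
- by rewrite eta1 rmorph1.
Qed.

(** Intertwining and the hexagons are images under [al2] and [al3] of their ordinary counterparts;
    [al2] and [al] also turn the ordinary products into Hom-products. *)
Lemma hom_R_matrix (R S : A2) :
    R * S = 1 -> S * R = 1 -> al2 R = R ->
    (forall x, R * T x = tensor_flip (T x) * R) ->
    tensor_assoc (tensor_map T idfun R) = leg13 R * leg23 R ->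
    tensor_map idfun T R = leg13 R * leg12 R ->
  is_R_matrix al m eta Delta R.
Proof.
move=> RS SR alR RT Rl Rr; split=> //.
- by exists S; rewrite /tensor_inverse !tensor_mulE RS SR rmorph1 /tensor_one eta1.
- by move=> x; rewrite !tensor_mulE RT.
- rewrite -tensor_assoc_map tensor_map_T_al -al3_tensor_assoc Rl leg13_leg23.
  rewrite linear_sw; apply: eq_sw => a b; rewrite linear_sw; apply: eq_sw => c d.
  by rewrite -[LHS]/(al3 (a ⊗ (c ⊗ (b * d)))) tensor_mapE /= tensor_mapE mE.
- rewrite -[LHS]/(tensor_map al Delta R) tensor_map_al_T Rr leg13_leg12.
  rewrite linear_sw; apply: eq_sw => a b; rewrite linear_sw; apply: eq_sw => c d.
  by rewrite -[LHS]/(al3 ((a * c) ⊗ (d ⊗ b))) tensor_mapE /= tensor_mapE mE.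
Qed.
End Structure.

(** * Untwisting a monoidal Hom-bialgebra *)

Section Monoidal.
Variables (Delta : {linear A -> A2}) (R sigma rho : A2).
Hypothesis coalg : Hom_coalgebra_axioms al ai Delta (@aug k A).
Hypothesis compat : bialgebra_compat m eta Delta (@aug k A).
Hypothesis R_mx : is_monoidal_R_matrix al m eta Delta R.
Hypothesis sigma_twist : is_Drinfeld_twist al m eta Delta (@aug k A) sigma.
Hypothesis rho_inv : tensor_inverse m eta sigma rho.

Definition untwisted_comul x := Delta (al x).

Lemma untwisted_comul_linear : linear untwisted_comul.
Proof. by move=> c x y; rewrite /untwisted_comul !linearP. Qed.

(** [Delta] sends a Hom-product to [al2] of the ordinary product of the values, and this [al2] is
    absorbed since [al2] after [Delta] is [Delta] after [al]. *)
Lemma untwisted_comul_monoid_morphism : monoid_morphism untwisted_comul.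
Proof.
split=> [|x y].
  by rewrite /untwisted_comul rmorph1 -{1}eta1 (comul_one compat) /tensor_one eta1.
rewrite /untwisted_comul -mE (comul_mul compat) tensor_mulE rmorphM /=.
by rewrite !(hom_coalg_gammaD coalg).
Qed.

HB.instance Definition _ := GRing.isLinear.Build k _ _ _ untwisted_comul
  untwisted_comul_linear.
HB.instance Definition _ := GRing.isMonoidMorphism.Build _ _ untwisted_comul
  untwisted_comul_monoid_morphism.

Local Notation D := untwisted_comul.

Lemma untwisted_comul_al x : D (al x) = al2 (D x).
Proof. exact: hom_coalg_gammaD coalg _. Qed.

Lemma al2_inj : injective al2.
Proof. exact: can_inj (tensor_mapK alK alK). Qed.

(** The inverse of [al] in the monoidal axioms cancels here; on [al2]-invariant elements such as R
    and sigma, [ai] ⊗ [Delta] is therefore id ⊗ D. *)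
Lemma tensor_map_ai_Delta t : tensor_map ai Delta (al2 t) = comulr D t.
Proof.
move: t; apply: (tensor_ext (tensor_map ai Delta \o al2) (comulr D)) => a b.
by rewrite /= comulrE !tensor_mapE /= alK.
Qed.

Lemma tensor_map_Delta_ai t :
  tensor_assoc (tensor_map Delta ai (al2 t)) = comull D t.
Proof.
move: t; apply: (tensor_ext
  (@tensor_assoc k A A A \o (tensor_map Delta ai \o al2)) (comull D)) => a b.
by rewrite /= comullE !tensor_mapE /= alK.
Qed.

Lemma untwisted_coassoc x : comulr D (D x) = comull D (D x).
Proof.
rewrite -tensor_map_ai_Delta -tensor_map_Delta_ai -untwisted_comul_al.
(* One [al] comes from the definition of D, the other from commuting D with [al]. *)
rewrite tensor_assoc_map; exact: hom_coalg_coassoc coalg (al (al x)).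
Qed.

Lemma untwisted_aug_left x : aug_left (D x) = x.
Proof. by have := hom_coalg_counitl coalg (al x); rewrite alK. Qed.

Lemma untwisted_aug_right x : aug_right (D x) = x.
Proof. by have := hom_coalg_counitr coalg (al x); rewrite alK. Qed.

Lemma al2_unit_eq1 x : al2 x = 1 -> x = 1.
Proof. by move=> x1; apply: al2_inj; rewrite x1 rmorph1. Qed.

Lemma untwisted_inverse x y :
  tensor_inverse m eta x y -> x * y = 1 /\ y * x = 1.
Proof.
by rewrite /tensor_inverse !tensor_mulE /tensor_one eta1 => -[xy yx];
  split; apply: al2_unit_eq1.
Qed.

Lemma untwisted_R_comul x : R * D x = tensor_flip (D x) * R.
Proof.
by apply: al2_inj; rewrite -!tensor_mulE; apply: mRmx_comul R_mx (al x).
Qed.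

Lemma untwisted_R_comull : comull D R = leg13 R * leg23 R.
Proof.
(* Applying [ai] to the last factor of the monoidal hexagon removes [al] from the product r2 R2 and
   turns the left side into ([Delta] ⊗ [ai]) R, which is (D ⊗ id) R by invariance. *)
have [ai3 ai3E] : exists f : {linear A3 -> A3},
    forall a b c, f (a ⊗ (b ⊗ c)) = a ⊗ (b ⊗ ai c).
  exists (tensor_map idfun (tensor_map idfun ai)) => a b c.
  by rewrite /= tensor_mapE /= tensor_mapE.
have := congr1 ai3 (mRmx_comull R_mx); rewrite !linear_sw.
rewrite -tensor_map_Delta_ai (mRmx_alpha R_mx) tensor_assoc_map leg13_leg23.
move=> e.
transitivity (\sw_(a ⊗ b <- R) ai3 (\sw_(c ⊗ d <- Delta a) c ⊗ (d ⊗ b))).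
  by apply: eq_sw => a b; rewrite linear_sw; apply: eq_sw => c d; rewrite ai3E.
rewrite e; apply: eq_sw => a b; rewrite linear_sw; apply: eq_sw => c d.
by rewrite ai3E mE alK.
Qed.

Lemma untwisted_R_comulr : comulr D R = leg13 R * leg12 R.
Proof.
have [ai1 ai1E] : exists f : {linear A3 -> A3},
    forall a t, f (a ⊗ t) = ai a ⊗ t.
  by exists (tensor_map ai idfun) => a t; rewrite /= tensor_mapE.
have := congr1 ai1 (mRmx_comulr R_mx); rewrite !linear_sw.
rewrite -tensor_map_ai_Delta (mRmx_alpha R_mx) leg13_leg12.
move=> e; transitivity (\sw_(a ⊗ b <- R) ai1 (a ⊗ Delta b)).
  by apply: eq_sw => a b; rewrite ai1E.
rewrite e; apply: eq_sw => a b; rewrite linear_sw; apply: eq_sw => c d.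
by rewrite ai1E mE alK.
Qed.

(** The sums are exchanged to match the twist axiom, where the sum over the second copy of sigma is
    innermost. *)
Lemma al2_mul_sw x y :
  al2 (x * y) = \sw_(c ⊗ d <- y) \sw_(a ⊗ b <- x) m (a ⊗ c) ⊗ m (b ⊗ d).
Proof. by rewrite -tensor_mulE; apply: exchange_big. Qed.

(** After [al3], the two sides become those of the Hom-cocycle condition: [al] cancels [ai] in the
    outer leg, and [al2] makes the product in the other two legs a Hom-product. *)
Lemma untwisted_cocycle :
  leg23 sigma * comulr D sigma = leg12 sigma * comull D sigma.
Proof.
have al3_inj : injective al3.
  by apply: can_inj (tensor_mapK alK (tensor_mapK alK alK)).
apply: al3_inj; rewrite -tensor_map_ai_Delta -tensor_map_Delta_ai.
rewrite (twist_alpha sigma_twist).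
have -> : al3 (leg23 sigma * tensor_map ai Delta sigma) =
    \sw_(a ⊗ b <- sigma) a ⊗ al2 (sigma * Delta b).
  rewrite mulr_sumr linear_sum; apply: eq_bigr => p _.
  by rewrite leg23E tensM mul1r -[LHS]/(al3 _) tensor_mapE /= aiK.
have -> : al3 (leg12 sigma * tensor_assoc (tensor_map Delta ai sigma)) =
    \sw_(a ⊗ b <- sigma) tensor_assoc (al2 (sigma * Delta a) ⊗ b).
  have -> : leg12 sigma * tensor_assoc (tensor_map Delta ai sigma) =
      tensor_assoc (\sw_(a ⊗ b <- sigma) (sigma * Delta a) ⊗ ai b).
    rewrite leg12_assoc -rmorphM mulr_sumr; congr tensor_assoc.
    by apply: eq_bigr => p _; rewrite tensM mul1r.
  apply: (etrans (linear_sw (al3 \o @tensor_assoc k A A A) _ _)).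
  apply: eq_sw => a b /=.
  by rewrite al3_tensor_assoc tensor_mapE /= aiK.
have := twist_cocycle sigma_twist.
set l := (X in X = _); set r := (X in _ = X) => lr.
transitivity l; [|rewrite lr]; rewrite /l /r {l r lr}; apply: eq_bigr => p _.
  rewrite al2_mul_sw linear_sumr; apply: eq_bigr => q _.
  by rewrite /= linear_sumr.
rewrite al2_mul_sw linear_sumlz linear_sum; apply: eq_bigr => q _ /=.
rewrite linear_sumlz linear_sum; apply: eq_bigr => q' _ /=.
by rewrite tensor_assocE.
Qed.

(** The inverse of an element fixed by an algebra morphism is fixed too. *)
Lemma untwisted_rho_al : al2 rho = rho.
Proof.
have [sr rs] := untwisted_inverse rho_inv.
rewrite -[LHS]mul1r -rs -mulrA -{1}(twist_alpha sigma_twist) -rmorphM /= sr.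
by rewrite rmorph1 mulr1.
Qed.

(** The two Hom-products apply [al2] twice to [Delta x], giving D([al x]), while sigma and rho are
    fixed by [al2]. *)
Lemma twisted_comulE x :
  twisted_comul m Delta sigma rho x = twist D sigma rho (al x).
Proof.
have al_sigma := twist_alpha sigma_twist.
have al_rho := untwisted_rho_al.
rewrite /twisted_comul !tensor_mulE !rmorphM /= !al_sigma al_rho.
by rewrite /twist -!(hom_coalg_gammaD coalg).
Qed.

Lemma al2_flip x : al2 (tensor_flip x) = tensor_flip (al2 x).
Proof.
move: x; apply: (tensor_ext (al2 \o @tensor_flip k A A) (@tensor_flip k A A \o al2)).
by move=> a b; rewrite /= tensor_mapE !tensor_flipE tensor_mapE.
Qed.

Lemma monoidal_twist_quasitriangular :
  is_quasitriangular_Hom_bialgebra al m eta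
    (twisted_comul m Delta sigma rho) (@aug k A).
Proof.
have -> : twisted_comul m Delta sigma rho = (fun x => twist D sigma rho (al x)).
  by apply: funext => x; apply: twisted_comulE.
have [sr rs] := untwisted_inverse rho_inv.
have [S /untwisted_inverse[RS SR]] := mRmx_invertible R_mx.
have al_sigma := twist_alpha sigma_twist.
have al_rho := untwisted_rho_al.
have T_al x : twist D sigma rho (al x) = al2 (twist D sigma rho x).
  by rewrite /twist !rmorphM /= al_sigma al_rho untwisted_comul_al.
have s_left : aug_left sigma = 1.
  by rewrite -eta1; apply: twist_counitl sigma_twist.
have s_right : aug_right sigma = 1.
  by rewrite -eta1; apply: twist_counitr sigma_twist.
split.
  apply: hom_bialgebra => //.
  - exact: twistM rs.
  - exact: twist1 sr.
  - exact: twist_coassoc sr rs untwisted_cocycle untwisted_coassoc.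
  - exact: twist_aug_left sr untwisted_aug_left s_left.
  - exact: twist_aug_right sr untwisted_aug_right s_right.
exists (twist_R sigma rho R).
have [R_S S_R] := twist_R_inv sr rs RS SR.
apply: (hom_R_matrix T_al R_S S_R).
- by rewrite /twist_R !rmorphM /= al2_flip al_sigma al_rho (mRmx_alpha R_mx).
- by move=> x; rewrite (twist_R_comul rs untwisted_R_comul).
- exact (twist_R_comull sr rs untwisted_cocycle untwisted_R_comul untwisted_R_comull).
- exact (twist_R_comulr sr rs untwisted_cocycle untwisted_R_comul untwisted_R_comulr).
Qed.
End Monoidal.

End HomTwist.

(* The index [V] lets elimination replace an lmodType by the one underlying an
   algebra, instead of relying on conversion between the two. *)
Inductive aug_algebra_structure (k : comNzRingType) :
    forall V : lmodType k, (V -> V -> V) -> V -> (V -> k) -> Prop :=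
  AugAlgebraStructure (A : augAlgType k) :
    @aug_algebra_structure k A *%R 1 (@aug k A).

(* There is no eta for structure types: an lmodType must be an explicit [Pack]
   to be convertible to the one underlying the algebra built on its carrier. *)
Section Packing.
Context {k : comNzRingType} {T : Type} (cls : GRing.Lmodule.axioms_ k T).
Let V : lmodType k := GRing.Lmodule.Pack cls.
Variables (mul : V -> V -> V) (one : V) (eps : V -> k).
Hypotheses (mulA : associative mul) (mul1l : left_id one mul).
Hypotheses (mul1r : right_id one mul) (mulPl : forall b, linear (mul^~ b)).
Hypotheses (mulPr : forall a, linear (mul a)) (eps_linear : scalar eps).
Hypotheses (eps1 : eps one = 1) (epsM : forall a b, eps (mul a b) = eps a * eps b).

Lemma packed_mulZl c a b : c *: mul a b = mul (c *: a) b.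
Proof. exact: esym (scalable_linear (mulPl b) c a). Qed.

Lemma packed_mulZr c a b : c *: mul a b = mul a (c *: b).
Proof. exact: esym (scalable_linear (mulPr a) c b). Qed.

Lemma packed_mulDl : left_distributive mul +%R.
Proof. by move=> a a' b; have := mulPl b 1 a a'; rewrite !scale1r. Qed.

Lemma packed_mulDr : right_distributive mul +%R.
Proof. by move=> a b b'; have := mulPr a 1 b b'; rewrite !scale1r. Qed.

Definition packed_pzRing : pzRingType := HB.pack (GRing.Lmodule.sort V)
  (GRing.Zmodule_isPzRing.Build V mulA mul1l mul1r packed_mulDl packed_mulDr).

Lemma packed_neq0 : 1 != 0 :> packed_pzRing.
Proof.
apply/eqP=> /(congr1 eps)/eqP; rewrite -[1]/one eps1.
have := eps_linear (-1) 0 0.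
by rewrite /= scaler0 addr0 mulN1r addNr => ->; rewrite oner_eq0.
Qed.

Definition packed_nzRing : nzRingType := HB.pack (GRing.PzRing.sort packed_pzRing)
  (GRing.PzSemiRing_isNonZero.Build packed_pzRing packed_neq0).

Definition packed_lalg : lalgType k := HB.pack (GRing.Lmodule.sort V) packed_nzRing
  (GRing.Lmodule_isLalgebra.Build k packed_nzRing packed_mulZl).

Definition packed_alg : algType k := HB.pack (GRing.Lmodule.sort V) packed_lalg
  (GRing.Lalgebra_isAlgebra.Build k packed_lalg packed_mulZr).

Definition packed_augAlg : augAlgType k := HB.pack (GRing.Lmodule.sort V) packed_alg
  (hasAugmentation.Build k packed_alg eps_linear (eps1, epsM)).

Lemma packed_structure : aug_algebra_structure mul one eps.
Proof. exact: AugAlgebraStructure packed_augAlg. Qed.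
End Packing.

Lemma aug_algebra_structureI (k : comNzRingType) (V : lmodType k)
    (mul : V -> V -> V) (one : V) (eps : V -> k) :
    associative mul -> left_id one mul -> right_id one mul ->
    (forall b, linear (mul^~ b)) -> (forall a, linear (mul a)) ->
    scalar eps -> eps one = 1 -> (forall a b, eps (mul a b) = eps a * eps b) ->
  aug_algebra_structure mul one eps.
Proof. by case: V mul one eps => T cls; apply: packed_structure. Qed.

(** Eliminating the structure hypothesis makes [mul], [one] and [eps] the operations of an augmented
    algebra; [alpha], [ai] and [Delta] can then be bundled as morphisms. *)
Lemma structure_twist_quasitriangular (k : comNzRingType) (V : lmodType k)
    (mul : V -> V -> V) (one : V) (eps : V -> k) (alpha ai : V -> V)
    (m : V ⊗[k] V -> V) (eta : k^o -> V) (Delta : V -> V ⊗[k] V)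
    (R sigma rho : V ⊗[k] V) :
    aug_algebra_structure mul one eps ->
    cancel alpha ai -> cancel ai alpha -> linear ai ->
    (forall a b, alpha (mul a b) = mul (alpha a) (alpha b)) ->
    (forall a b, m (a ⊗ b) = alpha (mul a b)) -> eta 1 = one ->
    is_Hom_algebra alpha m eta -> Hom_coalgebra_axioms alpha ai Delta eps ->
    bialgebra_compat m eta Delta eps ->
    is_monoidal_R_matrix alpha m eta Delta R ->
    is_Drinfeld_twist alpha m eta Delta eps sigma ->
    tensor_inverse m eta sigma rho ->
  is_quasitriangular_Hom_bialgebra alpha m eta
    (twisted_comul m Delta sigma rho) eps.
Proof.
move=> st; case: V mul one eps / st alpha ai m eta Delta R sigma rho => A.
move=> alpha ai m eta Delta R sigma rho alK aiK ai_lin al_mul mE eta1 alg coalg.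
move=> compat R_mx sigma_twist rho_inv.
have al1 : alpha 1 = 1 by rewrite -eta1 (hom_alg_alpha1 alg).
pose al : {lrmorphism A -> A} := HB.pack alpha
  (GRing.isLinear.Build k A A *:%R alpha (hom_alg_alpha_linear alg))
  (GRing.isMonoidMorphism.Build A A alpha (al1, al_mul)).
pose ai' : {linear A -> A} :=
  HB.pack ai (GRing.isLinear.Build k A A *:%R ai ai_lin).
pose Delta' : {linear A -> A ⊗[k] A} := HB.pack Delta
  (GRing.isLinear.Build k A (A ⊗[k] A) *:%R Delta (hom_coalg_comul_linear coalg)).
exact: (@monoidal_twist_quasitriangular k A al ai' alK aiK
  (hom_coalg_eps_gamma coalg) m eta (hom_alg_mul_linear alg) mE
  (hom_alg_unit_linear alg) eta1 Delta' R sigma rho coalg compat R_mx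
  sigma_twist rho_inv).
Qed.

Theorem proposition4p9 (k : comNzRingType)
    (char0 : forall n : nat, n.+1%:R != 0 :> k)
    (H : lmodType k) (alpha : H -> H) (m : H ⊗[k] H -> H) (eta : k^o -> H)
    (Delta : H -> H ⊗[k] H) (eps : H -> k) (R sigma rho : H ⊗[k] H)
    (H_bialg : is_monoidal_Hom_bialgebra alpha m eta Delta eps)
    (R_mx : is_monoidal_R_matrix alpha m eta Delta R)
    (sigma_twist : is_Drinfeld_twist alpha m eta Delta eps sigma)
    (rho_inv : tensor_inverse m eta sigma rho) :
  is_quasitriangular_Hom_bialgebra alpha m eta
    (twisted_comul m Delta sigma rho) eps.
Proof.
have [[_ alg] [ai [alK aiK coalg]] compat] := H_bialg.
have ai_lin : linear ai.
  by move=> c x y; apply: (can_inj alK); rewrite (hom_alg_alpha_linear alg) !aiK.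
pose mul a b := ai (m (a ⊗ b)).
apply: (@structure_twist_quasitriangular _ _ mul (eta 1) _ _ ai _ _ _ R sigma rho
  _ alK aiK ai_lin _ _ erefl alg coalg compat R_mx sigma_twist rho_inv); first last.
- by move=> a b; rewrite /mul aiK.
- by move=> a b; rewrite /mul aiK -(hom_alg_alphaM alg) alK.
apply: aug_algebra_structureI.
(* Applying [alpha] twice clears both nested inverses and leaves Hom-associativity. *)
- move=> a b c; do 2!apply: (can_inj alK).
  by rewrite /mul !aiK !(hom_alg_alphaM alg) !aiK (hom_alg_mulA alg).
- by move=> a; rewrite /mul (hom_alg_mul1l alg) alK.
- by move=> a; rewrite /mul (hom_alg_mul1r alg) alK.
- by move=> b c a a'; rewrite /mul linearPl (hom_alg_mul_linear alg) ai_lin.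
- by move=> a c b b'; rewrite /mul linearPr (hom_alg_mul_linear alg) ai_lin.
- exact: hom_coalg_counit_linear coalg.
- exact: counit_one compat.
- by move=> a b; rewrite -(hom_coalg_eps_gamma coalg) aiK (counit_mul compat).
Qed.
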